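(* Let $X\in P^2\mathcal{O}$ and let $Y\in\mathfrak{J}$ satisfy $X\circ Y=\frac12Y$ and $\|Y\|_{\mathbb{P}}=1$. Then the geodesic $\gamma(t)$ on $P^2\mathcal{O}$ through the point $X$ with direction $Y$ (i.e. $\gamma(0)=X$, $\gamma'(0)=Y$) is given by $$\gamma(t)=\cos 2t\cdot\Bigl(X-\frac12Y\circ Y\Bigr)+\frac12\sin 2t\cdot Y+\frac12Y\circ Y .$$
   Context: Octonions: $\mathbb{H}$ is the quaternion algebra over $\mathbb{R}$ with basis $e_0=1,e_1,e_2,e_3$ ($e_i^2=-1$, $e_1e_2=-e_2e_1=e_3$ and cyclic permutations), $\theta$ is quaternion conjugation. The Cayley algebra is $\mathcal{O}=\mathbb{H}\oplus\mathbb{H}e_4$ with product $(a+be_4)(h+ke_4)=ah-\theta(k)b+\{ka+b\theta(h)\}e_4$; $e_5=e_1e_4$, $e_6=e_2e_4$, $e_7=e_3e_4$, and $\theta(\sum_{i=0}^7h_ie_i)=h_0e_0-\sum_{i=1}^7h_ie_i$. Jordan algebra: $\mathfrak{J}=\{X\in M(3,\mathcal{O}) : \theta({}^tX)=X\}$ (with $\theta$ applied entrywise), with Jordan product $X\circ Y=\frac12(XY+YX)$ and inner product $(X,Y)=\operatorname{tr}(X\circ Y)\in\mathbb{R}$, where $\operatorname{tr}$ is the sum of the diagonal entries. Cayley projective plane: $P^2\mathcal{O}=\{X\in\mathfrak{J} : X\circ X=X,\ \operatorname{tr}X=1\}$, whose tangent space at $X$ is $\{Y\in\mathfrak{J} :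 X\circ Y=\frac12Y\}$. The Riemannian metric on $P^2\mathcal{O}$ is $(Y_1,Y_2)_{\mathbb{P}}=\frac12(Y_1,Y_2)$, with norm $\|\cdot\|_{\mathbb{P}}$. *)

(* Defs.v *)
From Stdlib Require Import Reals Lra.
From Coquelicot Require Import Coquelicot.
Open Scope R_scope.

(* Tuples of reals, so that Coquelicot's product structures provide [plus],
   [opp], [scal] and [is_derive] on quaternions and octonions.
   (h0, h1, h2, h3) stands for h0 + h1 e1 + h2 e2 + h3 e3. *)
Definition quat : Type := (R * R * R * R)%type.

(* (a, b) stands for a + b e4; the coordinates of b are those on e4, e5 = e1 e4,
   e6 = e2 e4, e7 = e3 e4. *)
Definition oct : Type := (quat * quat)%type.

Definition qmul (a b : quat) : quat :=
  let '(a0, a1, a2, a3) := a in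
  let '(b0, b1, b2, b3) := b in
  (a0 * b0 - a1 * b1 - a2 * b2 - a3 * b3,
   a0 * b1 + a1 * b0 + a2 * b3 - a3 * b2,
   a0 * b2 - a1 * b3 + a2 * b0 + a3 * b1,
   a0 * b3 + a1 * b2 - a2 * b1 + a3 * b0).

Definition qconj (a : quat) : quat :=
  let '(a0, a1, a2, a3) := a in (a0, - a1, - a2, - a3).

Definition omul (x y : oct) : oct :=
  let '(a, b) := x in
  let '(h, k) := y in
  (minus (qmul a h) (qmul (qconj k) b), plus (qmul k a) (qmul b (qconj h))).

Definition oconj (x : oct) : oct := let '(a, b) := x in (qconj a, opp b).

Definition ore (x : oct) : R := let '((x0, _, _, _), _) := x in x0.

Definition oreal (r : R) : oct := ((r, 0, 0, 0), (0, 0, 0, 0)).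

Inductive idx3 : Type := I1 | I2 | I3.

Definition sum3 (f : idx3 -> oct) : oct := plus (plus (f I1) (f I2)) (f I3).

Definition mat3 : Type := idx3 -> idx3 -> oct.

Definition mzero : mat3 := fun _ _ => oreal 0.
Definition madd (A B : mat3) : mat3 := fun i j => plus (A i j) (B i j).
Definition msub (A B : mat3) : mat3 := fun i j => minus (A i j) (B i j).
Definition mscal (r : R) (A : mat3) : mat3 := fun i j => scal r (A i j).
Definition mmul (A B : mat3) : mat3 :=
  fun i j => sum3 (fun k => omul (A i k) (B k j)).
Definition mconjtr (A : mat3) : mat3 := fun i j => oconj (A j i).
Definition mtr (A : mat3) : oct := sum3 (fun i => A i i).

Declare Scope mat3_scope.
Delimit Scope mat3_scope with M3.
Bind Scope mat3_scope with mat3.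
Infix "+" := madd : mat3_scope.
Infix "-" := msub : mat3_scope.
Notation "r *: A" := (mscal r%R A%M3)
  (at level 40, left associativity) : mat3_scope.

Definition jordan (A B : mat3) : mat3 :=
  (1 / 2 *: (mmul A B + mmul B A))%M3.
Infix "\o" := jordan (at level 40, left associativity) : mat3_scope.

Definition in_J (X : mat3) : Prop := mconjtr X = X.

(* The trace of X \o Y is a real octonion when X and Y are in J (see
   [mtr_jordan_real]); [ore] reads it as an element of R. *)
Definition inner (X Y : mat3) : R := ore (mtr (X \o Y)%M3).

Definition in_P2O (X : mat3) : Prop :=
  in_J X /\ (X \o X)%M3 = X /\ mtr X = oreal 1.

Definition tangent (X Y : mat3) : Prop :=
  in_J Y /\ (X \o Y)%M3 = (1 / 2 *: Y)%M3.

Definition innerP (Y1 Y2 : mat3) : R := 1 / 2 * inner Y1 Y2.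
Definition normP (Y : mat3) : R := sqrt (innerP Y Y).

Definition is_mderive (c : R -> mat3) (t : R) (D : mat3) : Prop :=
  forall i j : idx3, is_derive (fun s => c s i j) t (D i j).

Definition smooth (c : R -> mat3) : Prop :=
  exists D : nat -> R -> mat3,
    (forall t, D 0%nat t = c t) /\
    (forall n t, is_mderive (D n) t (D (S n) t)).

(* Covariant derivative at time t of a vector field V along the curve c, for
   the Levi-Civita connection of P^2 O.  The metric of P^2 O is the restriction
   of the Euclidean product [innerP] of J, so this connection is the tangential
   part of the derivative in J: W is the [innerP]-orthogonal projection of V'(t)
   onto the tangent space at c(t). *)
Definition is_cov_derive (c V : R -> mat3) (t : R) (W : mat3) : Prop :=
  exists D : mat3,
    is_mderive V t D /\
    tangent (c t) W /\
    (forall Z, tangent (c t) Z -> innerP (D - W)%M3 Z = 0).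

Definition is_geodesic (c : R -> mat3) : Prop :=
  (forall t, in_P2O (c t)) /\
  smooth c /\
  exists V : R -> mat3,
    (forall t, is_mderive c t (V t)) /\
    (forall t, is_cov_derive c V t mzero).

Lemma mtr_jordan_real (X Y : mat3) :
  in_J X -> in_J Y -> mtr (X \o Y)%M3 = oreal (inner X Y).
Proof.
intros HX HY.
assert (eX : forall i j, X i j = oconj (X j i)).
{ intros i j. exact (eq_sym (f_equal (fun M => M i j) HX)). }
assert (eY : forall i j, Y i j = oconj (Y j i)).
{ intros i j. exact (eq_sym (f_equal (fun M => M i j) HY)). }
assert (HX' := fun i => eX i i).
assert (HY' := fun i => eY i i).
generalize (HX' I1) (HX' I2) (HX' I3) (HY' I1) (HY' I2) (HY' I3).
unfold inner, mtr, jordan, mscal, madd, mmul, sum3.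
rewrite (eX I2 I1), (eX I3 I1), (eX I3 I2), (eY I2 I1), (eY I3 I1), (eY I3 I2).
clear.
destruct (X I1 I1) as [[[[? ?] ?] ?] [[[? ?] ?] ?]],
  (X I2 I2) as [[[[? ?] ?] ?] [[[? ?] ?] ?]],
  (X I3 I3) as [[[[? ?] ?] ?] [[[? ?] ?] ?]],
  (Y I1 I1) as [[[[? ?] ?] ?] [[[? ?] ?] ?]],
  (Y I2 I2) as [[[[? ?] ?] ?] [[[? ?] ?] ?]],
  (Y I3 I3) as [[[[? ?] ?] ?] [[[? ?] ?] ?]],
  (X I1 I2) as [[[[? ?] ?] ?] [[[? ?] ?] ?]],
  (X I1 I3) as [[[[? ?] ?] ?] [[[? ?] ?] ?]],
  (X I2 I3) as [[[[? ?] ?] ?] [[[? ?] ?] ?]],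
  (Y I1 I2) as [[[[? ?] ?] ?] [[[? ?] ?] ?]],
  (Y I1 I3) as [[[[? ?] ?] ?] [[[? ?] ?] ?]],
  (Y I2 I3) as [[[[? ?] ?] ?] [[[? ?] ?] ?]].
cbn. intros E1 E2 E3 E4 E5 E6.
injection E1; injection E2; injection E3; injection E4; injection E5;
  injection E6; intros.
repeat match goal with
  | H : ?x = - ?x |- _ => assert (x = 0) by lra; clear H; subst x
  | H : ?x = opp ?x |- _ => assert (x = 0) by (cbn in H; lra); clear H; subst x
  end.
unfold oreal; repeat apply injective_projections;
  unfold plus, opp, scal, mult; cbn; unfold plus, opp, scal, mult; cbn; ring.
Qed.

(* Main.v *)
Require Import Defs.
From Stdlib Require Import Reals Lra FunctionalExtensionality.
From Coquelicot Require Import Coquelicot.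
Open Scope R_scope.

(** Write [Q] for [Y \o Y].  Everything rests on three relations valid for
    every point [X] of the plane and every tangent vector [Y] at [X] of
    Euclidean square norm [inner Y Y = 2], that is, of unit length:
    [X \o Q = X] ([point_square]), [Y \o Q = Y] ([cube_tangent]) and
    [Q \o Q = Q] ([square_idempotent]).  Geometrically, [Q] is the sum of two
    orthogonal points [X] and [Z] of the plane, the unit of a copy of the
    symmetric 2 x 2 real matrices spanned by [X], [Z], [Y], and the curve of
    the theorem is the circle of rank one projections in that copy.

    The relations come from the Cayley-Hamilton identity of the Albert algebra:
    [A^3 - tr A A^2 + (((tr A)^2 - tr A^2) / 2) A] is a multiple of the identity
    ([cubic_scalar]), a consequence of the alternative laws of the octonions.
    At [Y], and in polarized form ([cubic_polar]) at the pairs [X, Y] and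
    [Q, Y], it shows that each of [Y \o Q - Y], [X \o Q - X] and [Q \o Q - Q] is
    a multiple of the identity; each has trace zero because the trace form is
    associative ([inner_jordan]), hence vanishes.

    A curve [c] in the plane with velocity [V] and acceleration [D] satisfies
    [c \o c = c]; two differentiations give [2 (c \o V) = V], so [V] is tangent,
    and [D = 2 (V \o V + c \o D)].  When [D] is normal to the plane, [V] keeps
    its length ([speed_const]), so the three relations hold for [c] and [V] at
    all times.  By the first, the vector [2 (V \o V) - 4 c] solves the equation
    for [D] and is normal too; the difference of the two is both tangent and
    normal, hence zero by positivity of the trace form: a geodesic satisfies
    [D = 2 (V \o V) - 4 c] ([acceleration]).  Then
    [(V \o V)' = 2 (V \o D) = 4 (V \o (V \o V)) - 8 (V \o c) = 0] by the second
    relation, so [V \o V] keeps its initial value [Q] and the geodesic solves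
    the linear equation [c'' = 2 Q - 4 c] ([geodesic_ode]), whose solution with
    the given initial data is unique ([oscillator_unique]) and is the stated
    curve.  Conversely that curve lies in the plane and has [Q \o c = c] by the
    three relations, and this makes its acceleration [2 Q - 4 c] normal
    ([great_circle_geodesic]). *)

(** * Octonion identities *)

Ltac oct_destruct :=
  repeat match goal with
  | x : oct |- _ => destruct x as [[[[? ?] ?] ?] [[[? ?] ?] ?]]
  end.

(** An octonion identity is polynomial in the real coordinates involved, so it
    can be checked there. *)
Ltac oct_ring :=
  intros; oct_destruct;
  repeat apply injective_projections;
  cbv -[Rplus Rmult Ropp Rminus Rinv Rdiv IZR]; first [ring | field].

Definition osq (x : oct) : R := ore (omul x (oconj x)).

Lemma omul_plus_l (x y z : oct) :
  omul (plus x y) z = plus (omul x z) (omul y z).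
Proof. oct_ring. Qed.

Lemma omul_plus_r (x y z : oct) :
  omul z (plus x y) = plus (omul z x) (omul z y).
Proof. oct_ring. Qed.

Lemma omul_scal_l (r : R) (x y : oct) : omul (scal r x) y = scal r (omul x y).
Proof. oct_ring. Qed.

Lemma omul_scal_r (r : R) (x y : oct) : omul x (scal r y) = scal r (omul x y).
Proof. oct_ring. Qed.

Lemma omul_oreal_l (r : R) (x : oct) : omul (oreal r) x = scal r x.
Proof. oct_ring. Qed.

Lemma omul_oreal_r (r : R) (x : oct) : omul x (oreal r) = scal r x.
Proof. oct_ring. Qed.

Lemma oconj_oreal (r : R) : oconj (oreal r) = oreal r.
Proof. oct_ring. Qed.

Lemma oconj_plus (x y : oct) : oconj (plus x y) = plus (oconj x) (oconj y).
Proof. oct_ring. Qed.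

Lemma oconj_scal (r : R) (x : oct) : oconj (scal r x) = scal r (oconj x).
Proof. oct_ring. Qed.

Lemma oconj_involutive (x : oct) : oconj (oconj x) = x.
Proof. oct_ring. Qed.

Lemma oconj_omul (x y : oct) : oconj (omul x y) = omul (oconj y) (oconj x).
Proof. oct_ring. Qed.

(** This law and its mirror image are the alternativity of the octonions, the
    only substitute for associativity that the cubic identity uses off the
    diagonal. *)
Lemma omul_oconj_cancel (x y : oct) :
  omul x (omul (oconj x) y) = scal (osq x) y.
Proof. oct_ring. Qed.

Lemma omul_oconj_cancel_r (x y : oct) :
  omul (omul y (oconj x)) x = scal (osq x) y.
Proof. oct_ring. Qed.

Lemma ore_omulC (x y : oct) : ore (omul x y) = ore (omul y x).
Proof. oct_ring. Qed.

(** The associator of octonions is purely imaginary; this is what makes the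
    trace form associative. *)
Lemma ore_omulA (x y z : oct) :
  ore (omul (omul x y) z) = ore (omul x (omul y z)).
Proof. oct_ring. Qed.

Lemma ore_plus (x y : oct) : ore (plus x y) = ore x + ore y.
Proof. oct_ring. Qed.

Lemma ore_scal (r : R) (x : oct) : ore (scal r x) = r * ore x.
Proof. oct_ring. Qed.

Lemma oconj_fixed (x : oct) : oconj x = x -> x = oreal (ore x).
Proof.
destruct x as [[[[? ?] ?] ?] [[[? ?] ?] ?]]; cbn; intros [= ]; unfold oreal.
repeat f_equal; cbv -[Rplus Rmult Ropp Rminus Rinv Rdiv IZR] in *; lra.
Qed.

Lemma osq_coords (x0 x1 x2 x3 x4 x5 x6 x7 : R) :
  osq ((x0, x1, x2, x3), (x4, x5, x6, x7)) =
  x0 * x0 + x1 * x1 + x2 * x2 + x3 * x3 +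
  (x4 * x4 + x5 * x5 + x6 * x6 + x7 * x7).
Proof. cbv -[Rplus Rmult Ropp Rminus Rinv Rdiv IZR]; ring. Qed.

Lemma osq_ge0 (x : oct) : 0 <= osq x.
Proof.
destruct x as [[[[? ?] ?] ?] [[[? ?] ?] ?]]; rewrite osq_coords.
repeat apply Rplus_le_le_0_compat; apply Rle_0_sqr.
Qed.

Lemma osq_eq0 (x : oct) : osq x = 0 -> x = oreal 0.
Proof.
destruct x as [[[[? ?] ?] ?] [[[? ?] ?] ?]]; rewrite osq_coords.
intros H; unfold oreal; repeat f_equal; apply Rsqr_0_uniq; unfold Rsqr; nra.
Qed.

(** * Linear identities and the Jordan product *)

Lemma mat3_ext (A B : mat3) : (forall i j, A i j = B i j) -> A = B.
Proof.
now intros H; apply functional_extensionality; intros i;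
  apply functional_extensionality; intros j; apply H.
Qed.

(** The eight coordinate projections are already enough to separate octonions;
    quantifying over all linear functionals [l] turns an identity between sums
    and multiples of octonions into a real one in which each [l x] is an atom,
    and a differential equation in octonions into a scalar one. *)
Lemma oct_functional_ext (x y : oct) :
  (forall l : oct -> R, is_linear l -> l x = l y) -> x = y.
Proof.
intros H.
repeat apply injective_projections;
  match goal with |- @eq R ?a _ =>
    let f := eval pattern x in a in
    match f with ?l _ => apply (H l) end end;
  repeat (apply is_linear_fst || apply is_linear_snd ||
    refine (is_linear_comp (fun u => _) fst _ is_linear_fst) ||
    refine (is_linear_comp (fun u => _) snd _ is_linear_snd)).
Qed.

Ltac oct_lin :=
  let l := fresh "l" in let Hl := fresh "Hl" in
  apply oct_functional_ext; intros l Hl;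
  repeat first [rewrite (linear_plus l Hl) | rewrite (linear_minus l _ _ Hl)
    | rewrite (linear_scal l Hl) ];
  unfold plus, minus, opp, scal; cbn; unfold mult; cbn; field.

Definition coord (i j : idx3) (l : oct -> R) (A : mat3) : R := l (A i j).

Lemma mat3_coord_ext (A B : mat3) :
  (forall i j l, is_linear l -> coord i j l A = coord i j l B) -> A = B.
Proof.
now intros H; apply mat3_ext; intros i j; apply oct_functional_ext; intros l;
  apply H.
Qed.

Lemma coord_add i j l A B : is_linear l ->
  coord i j l (A + B)%M3 = coord i j l A + coord i j l B.
Proof. intros Hl; exact (linear_plus l Hl _ _). Qed.

Lemma coord_sub i j l A B : is_linear l ->
  coord i j l (A - B)%M3 = coord i j l A - coord i j l B.
Proof. intros Hl; exact (linear_minus l _ _ Hl). Qed.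

Lemma coord_scal i j l r A : is_linear l ->
  coord i j l (r *: A)%M3 = r * coord i j l A.
Proof. intros Hl; exact (linear_scal l Hl _ _). Qed.

Lemma coord_zero i j l : is_linear l -> coord i j l mzero = 0.
Proof. intros Hl; exact (linear_zero l Hl). Qed.

(** Proves a linear identity between matrices from those linear identities
    between matrices that are in the context, treating every matrix that is not
    a sum, a difference or a multiple as an atom. *)
Ltac mat_lra :=
  let i := fresh "i" in let j := fresh "j" in
  let l := fresh "l" in let Hl := fresh "Hl" in
  apply mat3_coord_ext; intros i j l Hl;
  repeat match goal with
  | H : @eq mat3 _ _ |- _ => apply (f_equal (coord i j l)) in H
  end;
  repeat (rewrite ?(coord_add _ _ _ _ _ Hl), ?(coord_sub _ _ _ _ _ Hl),
    ?(coord_scal _ _ _ _ _ Hl), ?(coord_zero _ _ _ Hl) in * );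
  lra.

Lemma jordanC (A B : mat3) : (A \o B = B \o A)%M3.
Proof. unfold jordan; mat_lra. Qed.

Lemma mmul_add_l A B C : (mmul (A + B) C = mmul A C + mmul B C)%M3.
Proof.
apply mat3_ext; intros i j; unfold mmul, madd, sum3.
rewrite !omul_plus_l; oct_lin.
Qed.

Lemma mmul_add_r A B C : (mmul C (A + B) = mmul C A + mmul C B)%M3.
Proof.
apply mat3_ext; intros i j; unfold mmul, madd, sum3.
rewrite !omul_plus_r; oct_lin.
Qed.

Lemma mmul_scal_l r A B : (mmul (r *: A) B = r *: mmul A B)%M3.
Proof.
apply mat3_ext; intros i j; unfold mmul, mscal, sum3.
rewrite !omul_scal_l; oct_lin.
Qed.

Lemma mmul_scal_r r A B : (mmul A (r *: B) = r *: mmul A B)%M3.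
Proof.
apply mat3_ext; intros i j; unfold mmul, mscal, sum3.
rewrite !omul_scal_r; oct_lin.
Qed.

Lemma jordan_add_l A B C : ((A + B) \o C = A \o C + B \o C)%M3.
Proof. unfold jordan; rewrite mmul_add_l, mmul_add_r; mat_lra. Qed.

Lemma jordan_add_r A B C : (C \o (A + B) = C \o A + C \o B)%M3.
Proof. unfold jordan; rewrite mmul_add_l, mmul_add_r; mat_lra. Qed.

Lemma jordan_scal_l r A B : ((r *: A) \o B = r *: (A \o B))%M3.
Proof. unfold jordan; rewrite mmul_scal_l, mmul_scal_r; mat_lra. Qed.

Lemma jordan_scal_r r A B : (A \o (r *: B) = r *: (A \o B))%M3.
Proof. unfold jordan; rewrite mmul_scal_l, mmul_scal_r; mat_lra. Qed.

Lemma msub_add A B : (A - B = A + (-1) *: B)%M3.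
Proof. mat_lra. Qed.

Lemma jordan_sub_l A B C : ((A - B) \o C = A \o C - B \o C)%M3.
Proof. now rewrite !msub_add, jordan_add_l, jordan_scal_l. Qed.

Lemma jordan_sub_r A B C : (C \o (A - B) = C \o A - C \o B)%M3.
Proof. now rewrite !msub_add, jordan_add_r, jordan_scal_r. Qed.

(** * The trace form *)

Definition rtr (A : mat3) : R := ore (mtr A).

Lemma rtr_add A B : rtr (A + B)%M3 = rtr A + rtr B.
Proof. unfold rtr, mtr, madd, sum3; rewrite !ore_plus; ring. Qed.

Lemma rtr_scal r A : rtr (r *: A)%M3 = r * rtr A.
Proof. unfold rtr, mtr, mscal, sum3; rewrite !ore_plus, !ore_scal; ring. Qed.

Lemma rtr_sub A B : rtr (A - B)%M3 = rtr A - rtr B.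
Proof. rewrite msub_add, rtr_add, rtr_scal; ring. Qed.

Lemma rtr_mmulC A B : rtr (mmul A B) = rtr (mmul B A).
Proof.
unfold rtr, mtr, mmul, sum3; rewrite !ore_plus.
rewrite (ore_omulC (B I1 I1)), (ore_omulC (B I1 I2)), (ore_omulC (B I1 I3)),
  (ore_omulC (B I2 I1)), (ore_omulC (B I2 I2)), (ore_omulC (B I2 I3)),
  (ore_omulC (B I3 I1)), (ore_omulC (B I3 I2)), (ore_omulC (B I3 I3)); ring.
Qed.

(** Associativity holds term by term, because only real parts of products of
    three octonions occur. *)
Lemma rtr_mmulA A B C : rtr (mmul (mmul A B) C) = rtr (mmul A (mmul B C)).
Proof.
unfold rtr, mtr, mmul, sum3.
rewrite !omul_plus_l, !omul_plus_r, !ore_plus, !ore_omulA; ring.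
Qed.

Lemma inner_mmul A B : inner A B = rtr (mmul A B).
Proof.
unfold inner; fold (rtr (A \o B)%M3); unfold jordan.
rewrite rtr_scal, rtr_add, (rtr_mmulC B); field.
Qed.

Lemma rtr_jordan A B : rtr (A \o B)%M3 = inner A B.
Proof. reflexivity. Qed.

Lemma innerC A B : inner A B = inner B A.
Proof. unfold inner; now rewrite jordanC. Qed.

Lemma inner_add_r A B C : inner A (B + C)%M3 = inner A B + inner A C.
Proof. now rewrite <- !rtr_jordan, jordan_add_r, rtr_add. Qed.

Lemma inner_sub_r A B C : inner A (B - C)%M3 = inner A B - inner A C.
Proof. now rewrite <- !rtr_jordan, jordan_sub_r, rtr_sub. Qed.

Lemma inner_scal_r r A B : inner A (r *: B)%M3 = r * inner A B.
Proof. now rewrite <- !rtr_jordan, jordan_scal_r, rtr_scal. Qed.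

Lemma inner_add_l A B C : inner (B + C)%M3 A = inner B A + inner C A.
Proof. now rewrite !(innerC _ A), inner_add_r. Qed.

Lemma inner_sub_l A B C : inner (B - C)%M3 A = inner B A - inner C A.
Proof. now rewrite !(innerC _ A), inner_sub_r. Qed.

Lemma inner_scal_l r A B : inner (r *: B)%M3 A = r * inner B A.
Proof. now rewrite !(innerC _ A), inner_scal_r. Qed.

(** Associativity of the trace form: multiplication by [B] is self-adjoint. *)
Lemma inner_jordan A B C : inner (A \o B)%M3 C = inner A (B \o C)%M3.
Proof.
rewrite !inner_mmul; unfold jordan.
rewrite mmul_scal_l, mmul_scal_r, mmul_add_l, mmul_add_r, !rtr_scal, !rtr_add.
rewrite (rtr_mmulC (mmul B A) C), <- (rtr_mmulA C), (rtr_mmulC (mmul C B)).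
now rewrite rtr_mmulA.
Qed.

(** * Hermitian matrices and the cubic identity *)

Lemma mconjtr_add A B : mconjtr (A + B)%M3 = (mconjtr A + mconjtr B)%M3.
Proof. apply mat3_ext; intros i j; apply oconj_plus. Qed.

Lemma mconjtr_scal r A : mconjtr (r *: A)%M3 = (r *: mconjtr A)%M3.
Proof. apply mat3_ext; intros i j; apply oconj_scal. Qed.

Lemma mconjtr_mmul A B : mconjtr (mmul A B) = mmul (mconjtr B) (mconjtr A).
Proof.
apply mat3_ext; intros i j; unfold mconjtr, mmul, sum3.
now rewrite !oconj_plus, !oconj_omul.
Qed.

Lemma in_J_add A B : in_J A -> in_J B -> in_J (A + B)%M3.
Proof. unfold in_J; intros HA HB; now rewrite mconjtr_add, HA, HB. Qed.

Lemma in_J_scal r A : in_J A -> in_J (r *: A)%M3.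
Proof. unfold in_J; intros HA; now rewrite mconjtr_scal, HA. Qed.

Lemma in_J_sub A B : in_J A -> in_J B -> in_J (A - B)%M3.
Proof.
intros HA HB; rewrite msub_add; now apply in_J_add; [|apply in_J_scal].
Qed.

Lemma in_J_jordan A B : in_J A -> in_J B -> in_J (A \o B)%M3.
Proof.
unfold in_J, jordan; intros HA HB.
rewrite mconjtr_scal, mconjtr_add, !mconjtr_mmul, HA, HB; mat_lra.
Qed.

Lemma in_J_entry A i j : in_J A -> oconj (A j i) = A i j.
Proof. intros H; exact (f_equal (fun M => M i j) H). Qed.

(** On Hermitian matrices the trace form is the sum of the squared norms of the
    nine entries. *)
Lemma inner_self_eq0 A : in_J A -> inner A A = 0 -> A = mzero.
Proof.
intros HA; rewrite inner_mmul; unfold rtr, mtr, mmul, sum3.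
rewrite !ore_plus; intros H.
assert (E : forall i j, ore (omul (A i j) (A j i)) = osq (A i j)).
{ intros i j; now rewrite <- (in_J_entry A j i HA). }
rewrite !E in H.
apply mat3_ext; intros i j; apply osq_eq0; clear E.
assert (P := fun i j => osq_ge0 (A i j)).
assert (P11 := P I1 I1); assert (P12 := P I1 I2); assert (P13 := P I1 I3);
assert (P21 := P I2 I1); assert (P22 := P I2 I2); assert (P23 := P I2 I3);
assert (P31 := P I3 I1); assert (P32 := P I3 I2); assert (P33 := P I3 I3).
clear P; destruct i, j; lra.
Qed.

(** The off-diagonal entries are indexed cyclically ([x] at (2,3), [y] at (3,1),
    [z] at (1,2)), so that all formulas below are invariant under simultaneous
    rotation of [a, b, c] and of [x, y, z]. *)
Definition herm (a b c : R) (x y z : oct) : mat3 := fun i j =>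
  match i, j with
  | I1, I1 => oreal a | I2, I2 => oreal b | I3, I3 => oreal c
  | I2, I3 => x | I3, I2 => oconj x
  | I3, I1 => y | I1, I3 => oconj y
  | I1, I2 => z | I2, I1 => oconj z
  end.

Lemma in_J_herm A : in_J A ->
  A = herm (ore (A I1 I1)) (ore (A I2 I2)) (ore (A I3 I3))
           (A I2 I3) (A I3 I1) (A I1 I2).
Proof.
intros HA; apply mat3_ext; intros [] []; cbn;
  try (symmetry; now apply in_J_entry); try reflexivity;
  apply oconj_fixed; now apply in_J_entry.
Qed.

Arguments herm (_ _ _)%_R_scope _ _.

Definition mone : mat3 := herm 1 1 1 (oreal 0) (oreal 0) (oreal 0).

(** The generic characteristic polynomial of [A] without its constant term. *)
Definition cubic (A : mat3) : mat3 :=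
  (A \o (A \o A) - rtr A *: (A \o A)
   + (1 / 2 * (rtr A * rtr A - inner A A)) *: A)%M3.

(** The determinant (Freudenthal's cubic form) of [herm a b c x y z]. *)
Definition herm_det (a b c : R) (x y z : oct) : R :=
  a * b * c - a * osq x - b * osq y - c * osq z
  + 2 * ore (omul (omul x y) z).

(** The Euclidean product of octonions, polar form of [osq]. *)
Definition odot (x y : oct) : R := ore (omul x (oconj y)).

Lemma jordan_herm a b c x y z a' b' c' x' y' z' :
  (herm a b c x y z \o herm a' b' c' x' y' z' =
   herm (a * a' + odot y y' + odot z z') (b * b' + odot z z' + odot x x')
     (c * c' + odot x x' + odot y y')
     (scal (1 / 2)%R (plus (plus (scal (b + c)%R x') (scal (b' + c')%R x))
        (oconj (plus (omul y z') (omul y' z)))))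
     (scal (1 / 2)%R (plus (plus (scal (c + a)%R y') (scal (c' + a')%R y))
        (oconj (plus (omul z x') (omul z' x)))))
     (scal (1 / 2)%R (plus (plus (scal (a + b)%R z') (scal (a' + b')%R z))
        (oconj (plus (omul x y') (omul x' y))))))%M3.
Proof.
apply mat3_ext; intros [] []; unfold jordan, mscal, madd, mmul, sum3, herm.
(* Off the diagonal the octonion products match one by one; a diagonal entry is
   a real number only as a sum, so its coordinates have to be compared. *)
all: first
  [ rewrite ?oconj_scal, ?oconj_plus, ?oconj_omul, ?oconj_involutive,
      ?omul_oreal_l, ?omul_oreal_r; oct_lin
  | unfold odot; oct_ring ].
Qed.

Lemma odot_self (x : oct) : odot x x = osq x.
Proof. reflexivity. Qed.

Lemma jordan_herm_self a b c x y z :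
  (herm a b c x y z \o herm a b c x y z =
   herm (a * a + osq y + osq z) (b * b + osq z + osq x) (c * c + osq x + osq y)
     (plus (scal (b + c)%R x) (oconj (omul y z)))
     (plus (scal (c + a)%R y) (oconj (omul z x)))
     (plus (scal (a + b)%R z) (oconj (omul x y))))%M3.
Proof.
rewrite jordan_herm, !odot_self.
f_equal; rewrite oconj_plus; oct_lin.
Qed.

Lemma rtr_herm a b c x y z : rtr (herm a b c x y z) = a + b + c.
Proof. reflexivity. Qed.

Lemma inner_self_herm a b c x y z :
  inner (herm a b c x y z) (herm a b c x y z) =
  a * a + b * b + c * c + 2 * (osq x + osq y + osq z).
Proof. rewrite <- rtr_jordan, jordan_herm_self, rtr_herm; ring. Qed.

(** In this lemma and the next two, the sum of [scal r x] and of the conjugate of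
    a product is an off-diagonal entry of the square of a Hermitian matrix
    ([jordan_herm_self]), multiplied here by an entry of the matrix itself: these
    are the products that occur in its cube. *)
Lemma odot_square_entry (r : R) (x y z : oct) :
  odot x (plus (scal r x) (oconj (omul y z)))
  = r * osq x + ore (omul (omul x y) z).
Proof.
unfold odot; rewrite oconj_plus, oconj_scal, oconj_involutive, omul_plus_r.
now rewrite omul_scal_r, ore_plus, ore_scal, ore_omulA.
Qed.

Lemma omul_square_entry_r (r : R) (x y z : oct) :
  omul y (plus (scal r z) (oconj (omul x y)))
  = plus (scal r (omul y z)) (scal (osq y) (oconj x)).
Proof.
now rewrite omul_plus_r, omul_scal_r, oconj_omul, omul_oconj_cancel.
Qed.

Lemma omul_square_entry_l (r : R) (x y z : oct) :
  omul (plus (scal r y) (oconj (omul z x))) z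
  = plus (scal r (omul y z)) (scal (osq z) (oconj x)).
Proof.
now rewrite omul_plus_l, omul_scal_l, oconj_omul, omul_oconj_cancel_r.
Qed.

(** Named so that real octonions become multiples of one atom for [oct_lin],
    while [oreal] can be rewritten everywhere without looping. *)
Definition oone : oct := oreal 1.

Lemma orealE (r : R) : oreal r = scal r oone.
Proof. unfold oone; oct_ring. Qed.

Lemma ore_omul_cycle (x y z : oct) :
  ore (omul (omul y z) x) = ore (omul (omul x y) z).
Proof. now rewrite ore_omulC, ore_omulA. Qed.

(** The cubic identity. In the cube, the alternative laws turn the triple
    products off the diagonal into multiples of the entries, and on the diagonal
    the three triple products are cyclic rotations of one another with the same
    real part, which is why the three diagonal entries agree. *)
Lemma cubic_herm a b c x y z :
  cubic (herm a b c x y z) = (herm_det a b c x y z *: mone)%M3.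
Proof.
unfold cubic; rewrite inner_self_herm, rtr_herm, jordan_herm_self, jordan_herm.
rewrite !odot_square_entry, !omul_square_entry_l, !omul_square_entry_r.
rewrite <- !(ore_omul_cycle z x y), !(ore_omul_cycle x y z).
apply mat3_ext; intros [] [];
  unfold mone, mscal, madd, msub, herm, herm_det;
  rewrite ?oconj_scal, ?oconj_plus, ?oconj_scal, ?oconj_plus,
    ?oconj_involutive, ?oconj_scal, ?oconj_oreal, ?orealE;
  oct_lin.
Qed.

Lemma cubic_scalar A : in_J A -> exists n, cubic A = (n *: mone)%M3.
Proof.
intros HA; rewrite (in_J_herm A HA), cubic_herm; eexists; reflexivity.
Qed.

(** The part of [cubic (A + B)] that is of degree one in [A] and two in [B],
    extracted as half the second difference of [cubic] at [A] in the direction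
    [B]. *)
Lemma cubic_polar A B : in_J A -> in_J B -> exists n,
  (A \o (B \o B) + 2 *: (B \o (A \o B)) - rtr A *: (B \o B)
   - (2 * rtr B) *: (A \o B)
   + (1 / 2 * (rtr B * rtr B - inner B B)) *: A
   + (rtr A * rtr B - inner A B) *: B = n *: mone)%M3.
Proof.
intros HA HB.
destruct (cubic_scalar (A + B)%M3) as [n1 E1]; [now apply in_J_add|].
destruct (cubic_scalar (A - B)%M3) as [n2 E2]; [now apply in_J_sub|].
destruct (cubic_scalar A) as [n3 E3]; [assumption|].
exists (1 / 2 * (n1 + n2 - 2 * n3)); unfold cubic in *.
rewrite rtr_add, inner_add_l, !inner_add_r, (innerC B A) in E1.
rewrite rtr_sub, inner_sub_l, !inner_sub_r, (innerC B A) in E2.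
repeat first [rewrite jordan_add_l in E1 | rewrite jordan_add_r in E1].
repeat first [rewrite jordan_sub_l in E2 | rewrite jordan_sub_r in E2].
rewrite (jordanC B A) in E1, E2.
mat_lra.
Qed.

Lemma scalar_traceless A n : A = (n *: mone)%M3 -> rtr A = 0 -> A = mzero.
Proof.
intros -> H; unfold mone in H; rewrite rtr_scal, rtr_herm in H.
assert (n = 0) as -> by lra.
mat_lra.
Qed.

(** * Unit tangent vectors *)

Section Tangent.
Variables X V : mat3.
Hypotheses (HX : in_P2O X) (HV : tangent X V).

Let XJ : in_J X := proj1 HX.
Let XX : (X \o X)%M3 = X := proj1 (proj2 HX).
Let VJ : in_J V := proj1 HV.
Let XV : (X \o V = 1 / 2 *: V)%M3 := proj2 HV.

Lemma rtr_point : rtr X = 1.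
Proof. unfold rtr; now rewrite (proj2 (proj2 HX)). Qed.

Lemma inner_point_tangent : inner X V = 0.
Proof.
assert (E : inner X V = 1 / 2 * inner X V).
{ now rewrite <- XX at 1; rewrite inner_jordan, XV, inner_scal_r. }
lra.
Qed.

Lemma rtr_tangent : rtr V = 0.
Proof.
assert (E := inner_point_tangent).
rewrite <- rtr_jordan, XV, rtr_scal in E; lra.
Qed.

Hypothesis normV : inner V V = 2.

(** The part of degree two in [V] of the cubic identity at [X + V] says that
    [X \o (V \o V) - X] is a multiple of the identity. *)
Lemma point_square : (X \o (V \o V) = X)%M3.
Proof.
destruct (cubic_polar X V XJ VJ) as [n E].
rewrite rtr_point, rtr_tangent, inner_point_tangent, normV, XV, jordan_scal_r
  in E.
assert (E' : (X \o (V \o V) - X = n *: mone)%M3) by (rewrite <- E; mat_lra).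
apply scalar_traceless in E'; [mat_lra|].
rewrite rtr_sub, rtr_jordan, <- inner_jordan, XV, inner_scal_l, normV.
rewrite rtr_point; field.
Qed.

(** Replace the last [V] by [2 (X \o V)] and move [X] onto [V \o V] by
    associativity: the product is [X] again, which is orthogonal to [V]. *)
Lemma inner_square_self : inner (V \o V)%M3 V = 0.
Proof.
assert (E : inner (V \o V)%M3 (X \o V)%M3 = 0).
{ rewrite <- inner_jordan, (jordanC _ X), point_square.
  apply inner_point_tangent. }
rewrite XV, inner_scal_r in E; lra.
Qed.

Lemma cube_tangent : (V \o (V \o V) = V)%M3.
Proof.
destruct (cubic_scalar V VJ) as [n E]; unfold cubic in E.
rewrite rtr_tangent, normV in E.
assert (E' : (V \o (V \o V) - V = n *: mone)%M3) by (rewrite <- E; mat_lra).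
apply scalar_traceless in E'; [mat_lra|].
rewrite rtr_sub, rtr_jordan, innerC, inner_square_self, rtr_tangent; ring.
Qed.

(** The polarized cubic identity at [A = V \o V], [B = V], where
    [cube_tangent] reduces [V \o (V \o (V \o V))] to [V \o V]. *)
Lemma square_idempotent : ((V \o V) \o (V \o V) = V \o V)%M3.
Proof.
destruct (cubic_polar (V \o V) V (in_J_jordan V V VJ VJ) VJ) as [n E].
rewrite inner_square_self, rtr_tangent, normV, !(jordanC (V \o V) V),
  cube_tangent, rtr_jordan, normV in E.
assert (E' : ((V \o V) \o (V \o V) - V \o V = n *: mone)%M3)
  by (rewrite <- E; mat_lra).
apply scalar_traceless in E'; [mat_lra|].
rewrite rtr_sub, !rtr_jordan, inner_jordan, cube_tangent; ring.
Qed.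

End Tangent.

(** At a point fixed by [V \o V], both [X] and [V \o V] are orthogonal to the
    tangent space, as [Z = 2 (X \o Z)] there.  It serves for geodesics, where [V]
    is the velocity at [X], and for the explicit curve, where [V] is the initial
    velocity. *)
Lemma inner_tangent_normal X V Z : in_P2O X -> tangent X Z ->
  (X \o (V \o V))%M3 = X ->
  inner (2 *: (V \o V) - 4 *: X)%M3 Z = 0.
Proof.
intros HX HZ E.
assert (E0 := inner_point_tangent X Z HX HZ).
assert (E1 : inner (V \o V)%M3 (X \o Z)%M3 = 0).
{ now rewrite <- inner_jordan, (jordanC _ X), E. }
rewrite (proj2 HZ), inner_scal_r in E1.
rewrite inner_sub_l, !inner_scal_l; lra.
Qed.

(** * Derivatives of matrix-valued curves *)

Lemma is_derive_linear (U W : NormedModule R_AbsRing) (l : U -> W)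
    (f : R -> U) (t : R) (d : U) :
  is_linear l -> is_derive f t d -> is_derive (fun s => l (f s)) t (l d).
Proof.
intros Hl Hf.
apply (filterdiff_ext_lin _ (fun y : R => l (scal y d))).
- apply (filterdiff_comp' f l); [exact Hf|now apply filterdiff_linear].
- intros y; exact (linear_scal l Hl y d).
Qed.

Lemma is_derive_pair (U W : NormedModule R_AbsRing) (f : R -> U) (g : R -> W)
    (t : R) (d : U) (e : W) :
  is_derive f t d -> is_derive g t e ->
  is_derive (V := prod_NormedModule R_AbsRing U W)
    (fun s => (f s, g s)) t (d, e).
Proof.
intros Hf Hg.
apply (filterdiff_comp'_2 (K := R_AbsRing)
  (W := prod_NormedModule R_AbsRing U W) f g (fun u w => (u, w)) t _ _
  (fun u w => (u, w)) Hf Hg).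
apply filterdiff_linear.
apply is_linear_prod; [apply is_linear_fst|apply is_linear_snd].
Qed.

Lemma is_derive_oct_unique (f : R -> oct) t (d e : oct) :
  is_derive f t d -> is_derive f t e -> d = e.
Proof.
intros Hd He; apply oct_functional_ext; intros l Hl.
rewrite <- (is_derive_unique _ _ _ (is_derive_linear _ _ l f t d Hl Hd)).
exact (is_derive_unique _ _ _ (is_derive_linear _ _ l f t e Hl He)).
Qed.

(** Linearity of maps assembled from projections, opposites and pairs; each rule
    names the function because higher-order unification does not find it. *)
Ltac coords_linear :=
  repeat match goal with
  | |- is_linear (fun a => (@?f a, @?g a)) => apply (is_linear_prod f g)
  | |- is_linear (fun a => fst a) => apply is_linear_fst
  | |- is_linear (fun a => snd a) => apply is_linear_snd
  | |- is_linear (fun a => fst (@?f a)) =>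
      apply (is_linear_comp f fst); [|apply is_linear_fst]
  | |- is_linear (fun a => snd (@?f a)) =>
      apply (is_linear_comp f snd); [|apply is_linear_snd]
  | |- is_linear (fun a => opp (@?f a)) =>
      apply (is_linear_comp f opp); [|apply is_linear_opp]
  end.

Lemma is_linear_qconj : is_linear qconj.
Proof.
apply (is_linear_ext
  (fun a : quat => (fst (fst (fst a)), opp (snd (fst (fst a))),
     opp (snd (fst a)), opp (snd a)))).
{ now intros [[[? ?] ?] ?]. }
coords_linear.
Qed.

Lemma is_linear_ore : is_linear ore.
Proof.
apply (is_linear_ext (fun x : oct => fst (fst (fst (fst x))))).
{ now intros [[[[? ?] ?] ?] ?]. }
coords_linear.
Qed.

Lemma is_linear_oconj : is_linear oconj.
Proof.
apply (is_linear_ext (fun x : oct => (qconj (fst x), opp (snd x)))).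
{ now intros [? ?]. }
apply (is_linear_prod (fun x : oct => qconj (fst x)) (fun x => opp (snd x))).
- exact (is_linear_comp _ _ is_linear_fst is_linear_qconj).
- exact (is_linear_comp _ _ is_linear_snd is_linear_opp).
Qed.

Lemma is_derive_quat_coords (a : R -> quat) t (d : quat) :
  is_derive a t d -> exists a0 a1 a2 a3 : R -> R,
  (forall s, a s = (a0 s, a1 s, a2 s, a3 s)) /\
  is_derive a0 t (fst (fst (fst d))) /\ is_derive a1 t (snd (fst (fst d))) /\
  is_derive a2 t (snd (fst d)) /\ is_derive a3 t (snd d).
Proof.
intros Ha.
exists (fun s => fst (fst (fst (a s)))), (fun s => snd (fst (fst (a s)))),
  (fun s => snd (fst (a s))), (fun s => snd (a s)).
split; [now intros s; destruct (a s) as [[[? ?] ?] ?]|].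
refine (conj _ (conj _ (conj _ _)));
  repeat match goal with
  | |- is_derive (fun s => a s) _ _ => exact Ha
  | |- is_derive (fun s => fst (@?g s)) _ (fst ?e) =>
      apply (is_derive_linear _ _ fst g); [apply is_linear_fst|]
  | |- is_derive (fun s => snd (@?g s)) _ (snd ?e) =>
      apply (is_derive_linear _ _ snd g); [apply is_linear_snd|]
  end.
Qed.

Lemma is_derive_qmul (a b : R -> quat) t (a' b' : quat) :
  is_derive a t a' -> is_derive b t b' ->
  is_derive (fun s => qmul (a s) (b s)) t
    (plus (qmul a' (b t)) (qmul (a t) b')).
Proof.
intros Ha Hb.
destruct (is_derive_quat_coords a t a' Ha)
  as (a0 & a1 & a2 & a3 & Ea & A0 & A1 & A2 & A3).
destruct (is_derive_quat_coords b t b' Hb)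
  as (b0 & b1 & b2 & b3 & Eb & B0 & B1 & B2 & B3).
apply functional_extensionality in Ea, Eb; subst a b; clear Ha Hb.
destruct a' as [[[? ?] ?] ?], b' as [[[? ?] ?] ?].
cbn in A0, A1, A2, A3, B0, B1, B2, B3.
unfold qmul, plus; cbn; unfold plus; cbn.
repeat match goal with
  |- is_derive (fun s => (@?f s, @?g s)) _ _ => apply (is_derive_pair _ _ f g)
  end.
all: (auto_derive; [repeat split; eexists; eassumption|]).
all: rewrite
  (is_derive_unique (fun x : R => a0 x) _ _ A0),
  (is_derive_unique (fun x : R => a1 x) _ _ A1),
  (is_derive_unique (fun x : R => a2 x) _ _ A2),
  (is_derive_unique (fun x : R => a3 x) _ _ A3),
  (is_derive_unique (fun x : R => b0 x) _ _ B0),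
  (is_derive_unique (fun x : R => b1 x) _ _ B1),
  (is_derive_unique (fun x : R => b2 x) _ _ B2),
  (is_derive_unique (fun x : R => b3 x) _ _ B3).
all: unfold plus; cbn; ring.
Qed.

Lemma is_derive_omul (a b : R -> oct) t (a' b' : oct) :
  is_derive a t a' -> is_derive b t b' ->
  is_derive (fun s => omul (a s) (b s)) t
    (plus (omul a' (b t)) (omul (a t) b')).
Proof.
intros Ha Hb.
assert (C : forall (f : R -> oct) d, is_derive f t d ->
  exists g h : R -> quat, f = (fun s => (g s, h s)) /\
  is_derive g t (fst d) /\ is_derive h t (snd d)).
{ intros f d Hf; exists (fun s => fst (f s)), (fun s => snd (f s)).
  split; [now apply functional_extensionality; intros s; destruct (f s)|].
  exact (conj (is_derive_linear _ _ _ _ _ _ is_linear_fst Hf)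
           (is_derive_linear _ _ _ _ _ _ is_linear_snd Hf)). }
destruct (C a a' Ha) as (a0 & a1 & -> & A0 & A1).
destruct (C b b' Hb) as (b0 & b1 & -> & B0 & B1).
assert (B0c := is_derive_linear _ _ _ _ _ _ is_linear_qconj B0).
assert (B1c := is_derive_linear _ _ _ _ _ _ is_linear_qconj B1).
evar_last.
- exact (is_derive_pair _ _ _ _ _ _ _
    (is_derive_minus _ _ _ _ _
       (is_derive_qmul _ _ _ _ _ A0 B0) (is_derive_qmul _ _ _ _ _ B1c A1))
    (is_derive_plus _ _ _ _ _
       (is_derive_qmul _ _ _ _ _ B1 A0) (is_derive_qmul _ _ _ _ _ A1 B0c))).
- clear; cbn beta.
  destruct (a0 t) as [[[? ?] ?] ?], (a1 t) as [[[? ?] ?] ?],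
    (b0 t) as [[[? ?] ?] ?], (b1 t) as [[[? ?] ?] ?].
  clear; oct_ring.
Qed.

Lemma is_derive_sum3 (f : idx3 -> R -> oct) t (d : idx3 -> oct) :
  (forall k, is_derive (f k) t (d k)) ->
  is_derive (fun s => sum3 (fun k => f k s)) t (sum3 d).
Proof.
intros H; unfold sum3.
exact (is_derive_plus _ _ _ _ _ (is_derive_plus _ _ _ _ _ (H I1) (H I2))
  (H I3)).
Qed.

Lemma is_mderive_jordan (a b : R -> mat3) t (a' b' : mat3) :
  is_mderive a t a' -> is_mderive b t b' ->
  is_mderive (fun s => a s \o b s)%M3 t (a' \o b t + a t \o b')%M3.
Proof.
assert (H : forall (a b : R -> mat3) (a' b' : mat3),
  is_mderive a t a' -> is_mderive b t b' ->
  is_mderive (fun s => mmul (a s) (b s)) t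
    (mmul a' (b t) + mmul (a t) b')%M3).
{ clear; intros a b a' b' Ha Hb i j; unfold mmul, madd.
  evar_last.
  - apply (is_derive_sum3 (fun k s => omul (a s i k) (b s k j))).
    intros k; exact (is_derive_omul _ _ _ _ _ (Ha i k) (Hb k j)).
  - unfold sum3; cbn beta; oct_lin. }
intros Ha Hb i j; unfold jordan, mscal.
evar_last.
- apply (is_derive_linear _ _ (fun x : oct => scal (1 / 2) x)).
  + exact (is_linear_scal_r (K := R_AbsRing) (1 / 2) Rmult_comm).
  + exact (is_derive_plus _ _ _ _ _
      (H _ _ _ _ Ha Hb i j) (H _ _ _ _ Hb Ha i j)).
- unfold madd; oct_lin.
Qed.

Lemma is_mderive_unique (c : R -> mat3) t A B :
  is_mderive c t A -> is_mderive c t B -> A = B.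
Proof.
intros HA HB; apply mat3_ext; intros i j.
exact (is_derive_oct_unique _ _ _ _ (HA i j) (HB i j)).
Qed.

Lemma is_mderive_ext (c d : R -> mat3) t A :
  (forall s, c s = d s) -> is_mderive c t A -> is_mderive d t A.
Proof. intros H HA; now apply functional_extensionality in H as <-. Qed.

Lemma is_mderive_add (a b : R -> mat3) t a' b' :
  is_mderive a t a' -> is_mderive b t b' ->
  is_mderive (fun s => a s + b s)%M3 t (a' + b')%M3.
Proof.
intros Ha Hb i j; exact (is_derive_plus _ _ _ _ _ (Ha i j) (Hb i j)).
Qed.

Lemma is_mderive_scal_fun (f : R -> R) t f' (A : mat3) :
  is_derive f t f' -> is_mderive (fun s => f s *: A)%M3 t (f' *: A)%M3.
Proof. intros Hf i j; exact (is_derive_scal_l f t f' (A i j) Hf). Qed.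

Lemma is_derive_coord (c : R -> mat3) t A i j l : is_linear l ->
  is_mderive c t A -> is_derive (fun s => coord i j l (c s)) t (coord i j l A).
Proof. intros Hl H; exact (is_derive_linear _ _ l _ _ _ Hl (H i j)). Qed.

(** [mconjtr] is linear, so a curve fixed by it has a derivative fixed by it. *)
Lemma in_J_derive (c : R -> mat3) t A :
  (forall s, in_J (c s)) -> is_mderive c t A -> in_J A.
Proof.
intros Hc HA; apply (is_mderive_unique c t); [|exact HA].
apply (is_mderive_ext (fun s => mconjtr (c s))); [exact Hc|].
intros i j; exact (is_derive_linear _ _ _ _ _ _ is_linear_oconj (HA j i)).
Qed.

Lemma is_derive_inner (a b : R -> mat3) t a' b' :
  is_mderive a t a' -> is_mderive b t b' ->
  is_derive (fun s => inner (a s) (b s)) t (inner a' (b t) + inner (a t) b').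
Proof.
intros Ha Hb; assert (H := is_mderive_jordan a b t a' b' Ha Hb).
rewrite <- !rtr_jordan, <- rtr_add; unfold inner, rtr, mtr.
apply (is_derive_linear _ _ _ _ _ _ is_linear_ore).
exact (is_derive_sum3 (fun k s => (a s \o b s)%M3 k k) t _ (fun k => H k k)).
Qed.

Lemma derive_zero_const (f : R -> R) :
  (forall t, is_derive f t 0) -> forall t, f t = f 0.
Proof.
intros H t; destruct (Rtotal_order t 0) as [Ht|[->|Ht]]; [|reflexivity|].
- now apply (eq_is_derive f t 0).
- symmetry; now apply (eq_is_derive f 0 t).
Qed.

Lemma mderive_zero_const (c : R -> mat3) :
  (forall t, is_mderive c t mzero) -> forall t, c t = c 0.
Proof.
intros H t; apply mat3_coord_ext; intros i j l Hl.
apply (derive_zero_const (fun s => coord i j l (c s))); intros s.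
evar_last; [exact (is_derive_coord c s _ i j l Hl (H s))|now apply coord_zero].
Qed.

(** The energy [f'^2 + 4 f^2] is constant, hence zero. *)
Lemma oscillator_zero (f f' : R -> R) :
  (forall t, is_derive f t (f' t)) -> (forall t, is_derive f' t (- 4 * f t)) ->
  f 0 = 0 -> f' 0 = 0 -> forall t, f t = 0.
Proof.
intros Hf Hf' H0 H0' t.
assert (E : f' t * f' t + 4 * (f t * f t) = 0).
{ rewrite (derive_zero_const (fun s => f' s * f' s + 4 * (f s * f s))).
  - rewrite H0, H0'; ring.
  - intros s; evar_last.
    + apply (is_derive_plus (fun s => f' s * f' s) (fun s => 4 * (f s * f s))).
      * exact (Derive.is_derive_mult _ _ _ _ _ (Hf' s) (Hf' s)).
      * exact (is_derive_scal _ _ _ _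
          (Derive.is_derive_mult _ _ _ _ _ (Hf s) (Hf s))).
    + unfold plus; cbn; ring. }
nra.
Qed.

Lemma oscillator_unique (c d c' d' : R -> mat3) (Q : mat3) :
  (forall t, is_mderive c t (c' t)) -> (forall t, is_mderive d t (d' t)) ->
  (forall t, is_mderive c' t (2 *: Q - 4 *: c t)%M3) ->
  (forall t, is_mderive d' t (2 *: Q - 4 *: d t)%M3) ->
  c 0 = d 0 -> c' 0 = d' 0 -> forall t, c t = d t.
Proof.
intros Hc Hd Hc' Hd' H0 H0' t; apply mat3_coord_ext; intros i j l Hl.
apply Rminus_diag_uniq.
apply (oscillator_zero (fun s => coord i j l (c s) - coord i j l (d s))
         (fun s => coord i j l (c' s) - coord i j l (d' s))).
- intros s; exact (is_derive_minus _ _ _ _ _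
    (is_derive_coord c s _ i j l Hl (Hc s))
    (is_derive_coord d s _ i j l Hl (Hd s))).
- intros s; evar_last.
  + exact (is_derive_minus _ _ _ _ _
      (is_derive_coord c' s _ i j l Hl (Hc' s))
      (is_derive_coord d' s _ i j l Hl (Hd' s))).
  + rewrite !coord_sub, !coord_scal by assumption.
    unfold minus, plus, opp; cbn; ring.
- now rewrite H0, Rminus_diag.
- now rewrite H0', Rminus_diag.
Qed.

(** * Geodesics satisfy a linear equation *)

(** The equation for [D] determines it up to a tangent vector, and
    [2 (V \o V) - 4 X] is a solution that is normal. *)
Lemma normal_part X V D :
  in_P2O X -> tangent X V -> inner V V = 2 -> in_J D ->
  (D = 2 *: (V \o V + X \o D))%M3 ->
  (forall Z, tangent X Z -> inner D Z = 0) ->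
  D = (2 *: (V \o V) - 4 *: X)%M3.
Proof.
intros HX HV nV HD E HN.
assert (P := point_square X V HX HV nV).
set (N := (2 *: (V \o V) - 4 *: X)%M3).
assert (NJ : in_J N).
{ apply in_J_sub; apply in_J_scal; [apply in_J_jordan; apply HV|apply HX]. }
assert (HT : tangent X (D - N)%M3).
{ split; [now apply in_J_sub|].
  unfold N; rewrite !jordan_sub_r, !jordan_scal_r, P, (proj1 (proj2 HX)).
  mat_lra. }
assert (Z : (D - N)%M3 = mzero).
{ apply inner_self_eq0; [apply HT|].
  rewrite inner_sub_l, (HN _ HT).
  unfold N at 1; rewrite (inner_tangent_normal X V _ HX HT P); ring. }
clear E; mat_lra.
Qed.

Section Geodesic.
Variables (c V D : R -> mat3).
Hypotheses (cP : forall t, in_P2O (c t))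
  (cV : forall t, is_mderive c t (V t)) (VD : forall t, is_mderive V t (D t))
  (DN : forall t Z, tangent (c t) Z -> inner (D t) Z = 0).

Lemma velocity_tangent t : tangent (c t) (V t).
Proof.
split; [apply (in_J_derive c t); [intros s; apply cP|apply cV]|].
assert (E : V t = (V t \o c t + c t \o V t)%M3).
{ apply (is_mderive_unique c t); [apply cV|].
  apply (is_mderive_ext (fun s => c s \o c s)%M3); [intros s; apply cP|].
  now apply is_mderive_jordan. }
rewrite (jordanC (V t)) in E; mat_lra.
Qed.

Lemma speed_const t : inner (V t) (V t) = inner (V 0) (V 0).
Proof.
apply (derive_zero_const (fun s => inner (V s) (V s))); intros s.
evar_last; [exact (is_derive_inner _ _ _ _ _ (VD s) (VD s))|].
rewrite (innerC (V s)), (DN s _ (velocity_tangent s)); cbn; ring.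
Qed.

Lemma acceleration_eq t : (D t = 2 *: (V t \o V t + c t \o D t))%M3.
Proof.
assert (E : (1 / 2 *: D t = V t \o V t + c t \o D t)%M3).
{ apply (is_mderive_unique (fun s => 1 / 2 *: V s)%M3 t).
  - intros i j; exact (is_derive_linear _ _ (fun x : oct => scal (1 / 2) x)
      _ _ _ (is_linear_scal_r (K := R_AbsRing) (1 / 2) Rmult_comm) (VD t i j)).
  - apply (is_mderive_ext (fun s => c s \o V s)%M3).
    + intros s; apply velocity_tangent.
    + now apply is_mderive_jordan. }
mat_lra.
Qed.

Hypothesis nV : inner (V 0) (V 0) = 2.

Lemma acceleration t : D t = (2 *: (V t \o V t) - 4 *: c t)%M3.
Proof.
apply (normal_part (c t) (V t) (D t)).
- apply cP.
- apply velocity_tangent.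
- now rewrite speed_const.
- apply (in_J_derive V t); [intros s; apply velocity_tangent|apply VD].
- apply acceleration_eq.
- apply DN.
Qed.

(** The derivative [2 (V \o D)] of the left side vanishes by [acceleration] and
    [cube_tangent]. *)
Lemma velocity_square t : (V t \o V t)%M3 = (V 0 \o V 0)%M3.
Proof.
apply (mderive_zero_const (fun s => V s \o V s)%M3); intros s i j.
evar_last; [exact (is_mderive_jordan _ _ _ _ _ (VD s) (VD s) i j)|].
assert (Hs := velocity_tangent s).
assert (ns := speed_const s); rewrite nV in ns.
refine (f_equal (fun M : mat3 => M i j) (_ : _ = mzero)).
rewrite (jordanC (D s)), acceleration, jordan_sub_r, !jordan_scal_r.
rewrite (cube_tangent _ _ (cP s) Hs ns), (jordanC (V s)), (proj2 Hs); mat_lra.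
Qed.

Lemma geodesic_ode t :
  is_mderive V t (2 *: (V 0 \o V 0) - 4 *: c t)%M3.
Proof. rewrite <- (velocity_square t), <- acceleration; apply VD. Qed.

End Geodesic.

(** * The explicit curve is a geodesic *)

Definition great_circle (X Q Y : mat3) (t : R) : mat3 :=
  (cos (2 * t) *: (X - 1 / 2 *: Q) + (1 / 2 * sin (2 * t)) *: Y
   + 1 / 2 *: Q)%M3.

(** The [n]-th derivative of [great_circle X Q Y], in closed form: differentiating
    [cos (2 t)] or [sin (2 t)] doubles it and advances the phase by [PI / 2]. *)
Definition great_circle_deriv (X Q Y : mat3) (n : nat) (t : R) : mat3 :=
  ((2 ^ n * cos (2 * t + INR n * (PI / 2))) *: (X - 1 / 2 *: Q)
   + (1 / 2 * 2 ^ n * sin (2 * t + INR n * (PI / 2))) *: Y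
   + (match n with O => 1 / 2 | S _ => 0 end) *: Q)%M3.

Lemma great_circle_deriv0 X Q Y t :
  great_circle_deriv X Q Y 0 t = great_circle X Q Y t.
Proof.
unfold great_circle_deriv, great_circle; cbn [INR pow].
replace (2 * t + 0 * (PI / 2)) with (2 * t) by ring; mat_lra.
Qed.

Lemma great_circle_deriv2 X Q Y t :
  great_circle_deriv X Q Y 2 t = (2 *: Q - 4 *: great_circle X Q Y t)%M3.
Proof.
unfold great_circle_deriv, great_circle; cbn [INR pow].
replace (2 * t + (1 + 1) * (PI / 2)) with (2 * t + PI) by field.
rewrite neg_cos, neg_sin; mat_lra.
Qed.

Lemma great_circle_derive X Q Y n t :
  is_mderive (great_circle_deriv X Q Y n) t (great_circle_deriv X Q Y (S n) t).
Proof.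
unfold great_circle_deriv; apply is_mderive_add; [apply is_mderive_add|].
- apply is_mderive_scal_fun; auto_derive; [exact I|].
  rewrite S_INR, Rmult_plus_distr_r, Rmult_1_l, <- Rplus_assoc.
  rewrite (Rplus_comm _ (PI / 2)), cos_plus, cos_PI2, sin_PI2; cbn; ring.
- apply is_mderive_scal_fun; auto_derive; [exact I|].
  rewrite S_INR, Rmult_plus_distr_r, Rmult_1_l, <- Rplus_assoc.
  rewrite (Rplus_comm _ (PI / 2)), sin_plus, cos_PI2, sin_PI2; cbn; field.
- apply (is_mderive_scal_fun (fun _ => _)); exact (is_derive_const _ _).
Qed.

Lemma great_circle_velocity0 X Q Y : great_circle_deriv X Q Y 1 0 = Y.
Proof.
unfold great_circle_deriv; cbn [INR pow].
replace (2 * 0 + 1 * (PI / 2)) with (PI / 2) by field.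
rewrite cos_PI2, sin_PI2; mat_lra.
Qed.

Lemma great_circle0 X Q Y : great_circle X Q Y 0 = X.
Proof.
unfold great_circle; rewrite Rmult_0_r, cos_0, sin_0; mat_lra.
Qed.

Section GreatCircle.
Variables X Y : mat3.
Hypotheses (HX : in_P2O X) (HY : tangent X Y) (nY : inner Y Y = 2).

Let c := great_circle X (Y \o Y)%M3 Y.

(** [Y \o Y] is the unit of the subalgebra that contains the curve. *)
Lemma great_circle_square t : ((Y \o Y) \o c t = c t)%M3.
Proof.
unfold c, great_circle.
rewrite !jordan_add_r, !jordan_scal_r, jordan_sub_r, jordan_scal_r.
rewrite (square_idempotent X Y HX HY nY), (jordanC _ X),
  (point_square X Y HX HY nY), (jordanC (Y \o Y) Y), (cube_tangent X Y HX HY nY).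
reflexivity.
Qed.

Lemma great_circle_in_P2O t : in_P2O (c t).
Proof.
assert (QJ : in_J (Y \o Y)%M3) by (apply in_J_jordan; apply HY).
assert (CJ : in_J (c t)).
{ unfold c, great_circle.
  repeat match goal with
  | |- in_J (_ + _)%M3 => apply in_J_add
  | |- in_J (_ - _)%M3 => apply in_J_sub
  | |- in_J (_ *: _)%M3 => apply in_J_scal
  end; first [exact QJ | exact (proj1 HX) | exact (proj1 HY)]. }
split; [exact CJ|split].
- unfold c, great_circle.
  repeat first [rewrite jordan_add_r | rewrite jordan_add_l
    | rewrite jordan_sub_r | rewrite jordan_sub_l
    | rewrite jordan_scal_r | rewrite jordan_scal_l].
  rewrite (square_idempotent X Y HX HY nY), (jordanC (Y \o Y) X), (proj2 HY),
    (point_square X Y HX HY nY), (jordanC Y X), (proj2 HY),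
    (jordanC (Y \o Y) Y), (cube_tangent X Y HX HY nY), (proj1 (proj2 HX)).
  assert (S : sin (2 * t) * sin (2 * t) = 1 - cos (2 * t) * cos (2 * t)).
  { assert (T := sin2_cos2 (2 * t)); unfold Rsqr in T; lra. }
  apply mat3_coord_ext; intros i j l Hl.
  repeat (rewrite ?(coord_add _ _ _ _ _ Hl), ?(coord_sub _ _ _ _ _ Hl),
    ?(coord_scal _ _ _ _ _ Hl)).
  field [S].
- assert (T : mtr (c t) = oreal (rtr (c t))).
  { apply oconj_fixed; unfold mtr, sum3.
    now rewrite !oconj_plus, !(in_J_entry _ _ _ CJ). }
  rewrite T; f_equal; unfold c, great_circle.
  rewrite !rtr_add, !rtr_scal, rtr_sub, rtr_scal, rtr_jordan, nY,
    (rtr_point X HX), (rtr_tangent X Y HX HY); field.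
Qed.

Lemma great_circle_geodesic : is_geodesic c.
Proof.
split; [exact great_circle_in_P2O|split].
- exists (great_circle_deriv X (Y \o Y)%M3 Y); split.
  + apply great_circle_deriv0.
  + apply great_circle_derive.
- exists (great_circle_deriv X (Y \o Y)%M3 Y 1); split.
  + intros t; apply (is_mderive_ext (great_circle_deriv X (Y \o Y)%M3 Y 0)).
    * intros s; apply great_circle_deriv0.
    * apply great_circle_derive.
  + intros t; exists (great_circle_deriv X (Y \o Y)%M3 Y 2 t); split.
    { apply great_circle_derive. }
    split.
    { split; [apply mat3_ext; intros i j; apply oconj_oreal|].
      replace mzero with (0 *: mzero)%M3 by mat_lra.
      rewrite jordan_scal_r; mat_lra. }
    intros Z HZ; unfold innerP.
    replace (great_circle_deriv X (Y \o Y)%M3 Y 2 t - mzero)%M3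
      with (2 *: (Y \o Y) - 4 *: c t)%M3
      by (unfold c; rewrite great_circle_deriv2; mat_lra).
    rewrite (inner_tangent_normal (c t) Y Z (great_circle_in_P2O t) HZ); [ring|].
    rewrite jordanC; apply great_circle_square.
Qed.

End GreatCircle.

Theorem corollary2p2 (X Y : mat3) (gamma : R -> mat3)
  (hX : in_P2O X) (hYJ : in_J Y)
  (hXY : (X \o Y)%M3 = (1 / 2 *: Y)%M3) (hY : normP Y = 1) :
  (is_geodesic gamma /\ gamma 0 = X /\ is_mderive gamma 0 Y) <->
  (forall t : R,
     gamma t = (cos (2 * t) *: (X - 1 / 2 *: (Y \o Y))
                + (1 / 2 * sin (2 * t)) *: Y
                + 1 / 2 *: (Y \o Y))%M3).
Proof.
assert (HY : tangent X Y) by now split.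
assert (nY : inner Y Y = 2).
{ unfold normP, innerP in hY.
  assert (0 < 1 / 2 * inner Y Y)
    by (apply sqrt_lt_0_alt; rewrite sqrt_0, hY; lra).
  assert (E := sqrt_sqrt _ (Rlt_le _ _ H)); rewrite hY in E; lra. }
set (Q := (Y \o Y)%M3).
assert (C1 : forall t, is_mderive (great_circle X Q Y) t
  (great_circle_deriv X Q Y 1 t)).
{ intros t; apply (is_mderive_ext (great_circle_deriv X Q Y 0)).
  - intros s; apply great_circle_deriv0.
  - apply great_circle_derive. }
split.
- intros [(gP & [Ds [Ds0 Ds1]] & V & gV & VV) [g0 g'0]].
  (* Normality speaks at each time of some derivative of [V]; smoothness
     provides the acceleration as one differentiable function of time, and the
     two agree because derivatives are unique. *)
  apply functional_extensionality in Ds0.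
  assert (gDs : forall t, is_mderive gamma t (Ds 1%nat t)).
  { intros t; rewrite <- Ds0; apply Ds1. }
  assert (VDs : V = Ds 1%nat).
  { apply functional_extensionality; intros t.
    exact (is_mderive_unique gamma t _ _ (gV t) (gDs t)). }
  subst V.
  assert (V0 : Ds 1%nat 0 = Y)
    by exact (is_mderive_unique gamma 0 _ _ (gV 0) g'0).
  assert (DN : forall t Z, tangent (gamma t) Z -> inner (Ds 2%nat t) Z = 0).
  { intros t Z HZ; destruct (VV t) as (D & HD & _ & HN).
    rewrite (is_mderive_unique (Ds 1%nat) t _ _ (Ds1 1%nat t) HD).
    specialize (HN Z HZ); unfold innerP in HN.
    replace (D - mzero)%M3 with D in HN by mat_lra; lra. }
  apply (oscillator_unique gamma (great_circle X Q Y) (Ds 1%nat)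
           (great_circle_deriv X Q Y 1) Q gV C1).
  + unfold Q; rewrite <- V0.
    apply (geodesic_ode gamma (Ds 1%nat) (Ds 2%nat) gP gV (Ds1 1%nat) DN).
    now rewrite V0.
  + intros t; rewrite <- great_circle_deriv2; apply great_circle_derive.
  + now rewrite great_circle0.
  + now rewrite great_circle_velocity0.
- intros H; apply functional_extensionality in H.
  change (gamma = great_circle X Q Y) in H; subst gamma.
  split; [now apply great_circle_geodesic|split].
  + apply great_circle0.
  + rewrite <- (great_circle_velocity0 X Q Y) at 2; apply C1.
Qed.
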